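(* Let $D$ be a Dedekind domain with infinitely many maximal ideals, all of them of finite index, and let $K$ be its quotient field. Then for every $n\ge 1$ there exist elements $H,G_1,\ldots,G_{n+1}$ of $\operatorname{Int}(D)$, each irreducible in $\operatorname{Int}(D)$, such that \[x\,H(x)=G_1(x)\cdots G_{n+1}(x).\]
   Context: $\operatorname{Int}(D)=\{f\in K[x]\mid f(D)\subseteq D\}$ is the ring of integer-valued polynomials on $D$. An element is irreducible if it is a non-zero non-unit that cannot be written as a product of two non-units. *)

(* Defs.v *)
(* D is represented as a subring of its quotient field K. *)
From HB Require Import structures.
From mathcomp Require Import all_boot all_order all_algebra.
Set Implicit Arguments. Unset Strict Implicit. Unset Printing Implicit Defensive.
Import Order.TTheory GRing.Theory Num.Theory.
Local Open Scope ring_scope.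

Section Defs.
Variable K : fieldType.
Variable D : K -> Prop.

Definition is_subring : Prop :=
  D 1 /\ (forall x y, D x -> D y -> D (x - y)) /\ (forall x y, D x -> D y -> D (x * y)).

Definition is_quotient_field : Prop :=
  forall x : K, exists a b, D a /\ D b /\ b != 0 /\ x = a / b.

Definition ideal (I : K -> Prop) : Prop :=
  (forall x, I x -> D x) /\ I 0 /\ (forall x y, I x -> I y -> I (x + y)) /\
  (forall r x, D r -> I x -> I (r * x)).

Definition proper_ideal (I : K -> Prop) : Prop := ideal I /\ ~ I 1.

Definition prime_ideal (I : K -> Prop) : Prop :=
  proper_ideal I /\ (forall x y, D x -> D y -> I (x * y) -> I x \/ I y).

Definition maximal_ideal (I : K -> Prop) : Prop :=
  proper_ideal I /\
  (forall J, ideal J -> (forall x, I x -> J x) -> J 1 \/ (forall x, J x -> I x)).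

Definition finitely_generated (I : K -> Prop) : Prop :=
  exists s : seq K, (forall i, (i < size s)%N -> D s`_i) /\
    forall x, I x <-> exists r : 'I_(size s) -> K,
       (forall i, D (r i)) /\ x = \sum_(i < size s) r i * s`_i.

Definition noetherian : Prop := forall I, ideal I -> finitely_generated I.

Definition integrally_closed : Prop :=
  forall p : {poly K}, p \is monic -> (forall i, D p`_i) ->
    forall x, root p x -> D x.

Definition dim_le1 : Prop :=
  forall I, prime_ideal I -> (exists x, I x /\ x != 0) -> maximal_ideal I.

Definition dedekind_domain : Prop :=
  is_subring /\ noetherian /\ integrally_closed /\ dim_le1.

Definition finite_index (M : K -> Prop) : Prop :=
  exists s : seq K, forall d, D d -> exists2 i, (i < size s)%N & M (d - s`_i).

Definition infinitely_many_maximal_ideals : Prop :=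
  forall n (Ms : 'I_n -> (K -> Prop)), exists M, maximal_ideal M /\
    forall i, ~ (forall x, M x <-> Ms i x).

Definition int_valued (f : {poly K}) : Prop := forall d, D d -> D f.[d].

Definition Int_unit (f : {poly K}) : Prop :=
  int_valued f /\ exists g, int_valued g /\ f * g = 1.

Definition Int_irreducible (f : {poly K}) : Prop :=
  int_valued f /\ f != 0 /\ ~ Int_unit f /\
  forall g h, int_valued g -> int_valued h -> f = g * h -> Int_unit g \/ Int_unit h.

End Defs.

(* Main.v *)
(* Fix [c = q ^ n] with [q] irreducible in [D]. It suffices to find [H] in Int(D), irreducible
   over [K], with [H 0 = H c = 1] and [x H x] in [c D] for all [x] in [D]: then [x H =
   q ^ n * (x H / c)], and the values at [0] and [c] leave no room for constants in a factorization of
   [H] or [x H / c].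
   To find [H], cover [c D] by a product of maximal ideals [M]; for each [M] with local
   uniformizer [pi], a polynomial congruent to an indicator function of [M] can be iterated into
   an integer-valued [f] with [f 0 = 1] and [x f x] in [pi ^ e] locally at [M]. Multiply these.
   Finally perturb modulo [c] so that the reversed polynomial is Eisenstein at a maximal ideal
   that avoids [c] and all denominators. *)
Require Import Defs.
From HB Require Import structures.
From mathcomp Require Import all_boot all_order all_algebra.
From mathcomp Require Import perm ring.
From Stdlib Require Import Classical ClassicalEpsilon.
Import Order.TTheory GRing.Theory Num.Theory.
Local Open Scope ring_scope.

Set Implicit Arguments. Unset Strict Implicit. Unset Printing Implicit Defensive.

(** * Subrings of a field, and polynomials with coefficients in them *)

Section Subring.
Variables (K : fieldType) (S : K -> Prop).
Hypothesis subringS : is_subring S.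

Lemma subring1 : S 1. Proof. by case: subringS. Qed.
Lemma subringB x y : S x -> S y -> S (x - y). Proof. by case: subringS => _ [h _]; apply: h. Qed.
Lemma subringM x y : S x -> S y -> S (x * y). Proof. by case: subringS => _ [_ h]; apply: h. Qed.
Lemma subring0 : S 0. Proof. by rewrite -(subrr 1); apply: subringB; apply: subring1. Qed.
Lemma subringN x : S x -> S (- x).
Proof. by move=> hx; rewrite -sub0r; apply: subringB => //; apply: subring0. Qed.
Lemma subringD x y : S x -> S y -> S (x + y).
Proof. by move=> hx hy; rewrite -[y]opprK; apply: subringB => //; apply: subringN. Qed.
Lemma subringX x n : S x -> S (x ^+ n).
Proof.
by move=> hx; elim: n => [|n IH]; [rewrite expr0; apply: subring1 | rewrite exprS; apply: subringM].
Qed.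
Lemma subring_nat n : S n%:R.
Proof.
elim: n => [|n IH]; first exact: subring0.
by rewrite -natr1; apply: subringD => //; apply: subring1.
Qed.
Lemma subring_sum (I : Type) (r : seq I) (P : pred I) (F : I -> K) :
  (forall i, P i -> S (F i)) -> S (\sum_(i <- r | P i) F i).
Proof.
by move=> h; elim/big_rec: _ => [|i x Pi hx]; [apply: subring0 | apply: subringD => //; apply: h].
Qed.
Lemma subring_prod (I : Type) (r : seq I) (P : pred I) (F : I -> K) :
  (forall i, P i -> S (F i)) -> S (\prod_(i <- r | P i) F i).
Proof.
by move=> h; elim/big_rec: _ => [|i x Pi hx]; [apply: subring1 | apply: subringM => //; apply: h].
Qed.

(** The subring is a parameter because coefficients are taken in [D] and also in the larger ring
    [away]. *)
Definition coef_in (p : {poly K}) := forall i, S p`_i.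

Lemma coef_inC a : S a -> coef_in a%:P.
Proof. by move=> Sa i; rewrite coefC; case: eqP => _ //; apply: subring0. Qed.
Lemma coef_in0 : coef_in 0.
Proof. by move=> i; rewrite coef0; apply: subring0. Qed.
Lemma coef_inX : coef_in 'X.
Proof. by move=> i; rewrite coefX; apply: subring_nat. Qed.
Lemma coef_inD p q : coef_in p -> coef_in q -> coef_in (p + q).
Proof. by move=> hp hq i; rewrite coefD; apply: subringD. Qed.
Lemma coef_inB p q : coef_in p -> coef_in q -> coef_in (p - q).
Proof. by move=> hp hq i; rewrite coefB; apply: subringB. Qed.
Lemma coef_inM p q : coef_in p -> coef_in q -> coef_in (p * q).
Proof. by move=> hp hq k; rewrite coefM; apply: subring_sum => j _; apply: subringM. Qed.
Lemma coef_inZ a p : S a -> coef_in p -> coef_in (a *: p).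
Proof. by move=> Sa hp; rewrite -mul_polyC; apply: coef_inM => //; apply: coef_inC. Qed.
Lemma coef_in_prod (I : Type) (r : seq I) (P : pred I) (F : I -> {poly K}) :
  (forall i, P i -> coef_in (F i)) -> coef_in (\prod_(i <- r | P i) F i).
Proof.
move=> h; elim/big_rec: _ => [|i x Pi hx]; last by apply: coef_inM => //; apply: h.
by rewrite -polyC1; apply: coef_inC; apply: subring1.
Qed.
Lemma coef_inXn p n : coef_in p -> coef_in (p ^+ n).
Proof.
move=> hp; elim: n => [|n IH]; last by rewrite exprS; apply: coef_inM.
by rewrite expr0 -polyC1; apply: coef_inC; apply: subring1.
Qed.
Lemma coef_in_comp p q : coef_in p -> coef_in q -> coef_in (p \Po q).
Proof.
move=> hp hq; rewrite comp_polyE; elim/big_rec: _ => [|i x _ hx].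
  exact: coef_in0.
by apply: coef_inD => //; apply: coef_inZ => //; apply: coef_inXn.
Qed.
Lemma coef_in_horner p x : coef_in p -> S x -> S p.[x].
Proof.
by move=> hp Sx; rewrite horner_coef; apply: subring_sum => i _; apply: subringM => //; apply: subringX.
Qed.

End Subring.

(** * Ideals and localizations of a Dedekind domain *)

Section Dedekind.
Variables (K : fieldType) (D : K -> Prop).
Hypothesis dedD : dedekind_domain D.

Let ringD : is_subring D. Proof. by case: dedD. Qed.
Let noethD : noetherian D. Proof. by case: dedD => _ []. Qed.
Let closedD : integrally_closed D. Proof. by case: dedD => _ [_ []]. Qed.
Let dimD : dim_le1 D. Proof. by case: dedD => _ [_ []]. Qed.

Let sr1 := subring1 ringD.
Let sr0 := subring0 ringD.
Let srB := subringB ringD.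
Let srD := subringD ringD.
Let srN := subringN ringD.
Let srM := subringM ringD.
Let srX := subringX ringD.
Let sr_sum := subring_sum ringD.
Let sr_prod := subring_prod ringD.

Lemma generator_mem I (s : seq K) :
  (forall x, I x <-> exists r : 'I_(size s) -> K,
     (forall i, D (r i)) /\ x = \sum_(i < size s) r i * s`_i) ->
  forall i : 'I_(size s), I s`_i.
Proof.
move=> sI i; apply/sI; exists (fun j => (j == i)%:R); split.
  by move=> j; apply: subring_nat.
rewrite (bigD1 i) //= eqxx mul1r big1 ?addr0 // => j /negbTE ->.
by rewrite mul0r.
Qed.

(** Otherwise choice produces a strictly increasing chain in the family. Its union is a finitely
    generated ideal, so the chain stops growing at a stage containing all generators. *)
Lemma noetherian_max (Fam : (K -> Prop) -> Prop) :
  (forall I, Fam I -> ideal D I) -> (exists I, Fam I) ->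
  exists I, Fam I /\ forall J, Fam J -> (forall x, I x -> J x) -> forall x, J x -> I x.
Proof.
move=> Fid [I0 FI0]; apply: NNPP => nomax.
have step (A : {I | Fam I}) :
    {B : {I | Fam I} | (forall x, sval A x -> sval B x) /\ exists x, sval B x /\ ~ sval A x}.
  apply: constructive_indefinite_description; apply: NNPP => hno; apply: nomax.
  exists (sval A); split; first exact: svalP A.
  move=> J FJ AJ x Jx; apply: NNPP => nAx.
  by apply: hno; exists (exist _ J FJ); split => //=; exists x.
pose ch n := iter n (fun A => sval (step A)) (exist _ I0 FI0).
have chS n x : sval (ch n) x -> sval (ch n.+1) x.
  by case: (svalP (step (ch n))) => h _; apply: h.
have chle m n x : (m <= n)%N -> sval (ch m) x -> sval (ch n) x.
  move=> /subnK <-; elim: (n - m)%N => [//|k IH] h.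
  by rewrite addSn; apply: chS; apply: IH.
have chid n : ideal D (sval (ch n)) by apply: Fid; apply: svalP (ch n).
pose U x := exists n, sval (ch n) x.
have Uid : ideal D U.
  split; first by move=> x [n]; case: (chid n) => h _; apply: h.
  split; first by exists 0%N; case: (chid 0%N) => _ [].
  split.
    move=> x y [m hx] [n hy]; exists (maxn m n).
    case: (chid (maxn m n)) => _ [_ [h _]]; apply: h.
      by apply: chle hx; apply: leq_maxl.
    by apply: chle hy; apply: leq_maxr.
  move=> r x Dr [n hx]; exists n; case: (chid n) => _ [_ [_ h]]; exact: h.
have [s [sD sU]] := noethD Uid.
have sU' (i : 'I_(size s)) : {n | sval (ch n) s`_i}.
  by apply: constructive_indefinite_description; apply: (generator_mem sU).
pose N := \max_(i < size s) sval (sU' i).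
have [x [h1 h2]] := (svalP (step (ch N))).2.
apply: h2.
have /sU [r [rD ->]] : U x by exists N.+1.
case: (chid N) => _ [h0 [hadd hmul]].
elim/big_rec: _ => [//|i y _ hy]; apply: hadd => //; apply: hmul => //.
by apply: chle (svalP (sU' i)); apply: (leq_bigmax i).
Qed.

Lemma ideal_D I x : ideal D I -> I x -> D x.
Proof. by case=> h _; apply: h. Qed.
Lemma ideal0 I : ideal D I -> I 0. Proof. by case=> _ []. Qed.
Lemma idealD I x y : ideal D I -> I x -> I y -> I (x + y).
Proof. by case=> _ [_ [h _]]; apply: h. Qed.
Lemma idealM I r x : ideal D I -> D r -> I x -> I (r * x).
Proof. by case=> _ [_ [_ h]]; apply: h. Qed.
Lemma idealMr I r x : ideal D I -> D r -> I x -> I (x * r).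
Proof. by move=> *; rewrite mulrC; apply: idealM. Qed.
Lemma idealN I x : ideal D I -> I x -> I (- x).
Proof. by move=> hI hx; rewrite -mulN1r; apply: idealM => //; apply: srN; apply: sr1. Qed.
Definition add_principal (I : K -> Prop) (a : K) (z : K) :=
  exists x r, I x /\ D r /\ z = x + r * a.

Lemma add_principal_ideal I a : ideal D I -> D a -> ideal D (add_principal I a).
Proof.
move=> hI Da; split.
  by move=> z [x [r [Ix [Dr ->]]]]; apply: srD; [apply: ideal_D Ix | apply: srM].
split; first by exists 0, 0; rewrite mul0r addr0; split; [apply: ideal0 | split => //; apply: sr0].
split.
  move=> _ _ [x [r [Ix [Dr ->]]]] [y [s [Iy [Ds ->]]]].
  exists (x + y), (r + s); split; first exact: idealD.
  by split; [apply: srD | ring].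
move=> t _ Dt [x [r [Ix [Dr ->]]]]; exists (t * x), (t * r).
split; first exact: idealM.
by split; [apply: srM | ring].
Qed.

Lemma add_principal_sub I a x : I x -> add_principal I a x.
Proof. by move=> Ix; exists x, 0; rewrite mul0r addr0; split => //; split => //; apply: sr0. Qed.

Lemma add_principal_mem I a : ideal D I -> add_principal I a a.
Proof. by move=> hI; exists 0, 1; rewrite mul1r add0r; split; [apply: ideal0 | split => //; apply: sr1]. Qed.

Definition principal (a z : K) := exists r, D r /\ z = r * a.

Lemma principal_ideal a : D a -> ideal D (principal a).
Proof.
move=> Da; split; first by move=> z [r [Dr ->]]; apply: srM.
split; first by exists 0; rewrite mul0r; split => //; apply: sr0.
split.
  by move=> _ _ [r [Dr ->]] [s [Ds ->]]; exists (r + s); rewrite mulrDl; split => //; apply: srD.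
by move=> t _ Dt [r [Dr ->]]; exists (t * r); rewrite mulrA; split => //; apply: srM.
Qed.

Lemma principal_mem a : principal a a.
Proof. by exists 1; rewrite mul1r; split => //; apply: sr1. Qed.

(** The Noetherian property stands in for Zorn's lemma. *)
Lemma maximal_above I : Defs.proper_ideal D I ->
  exists M, maximal_ideal D M /\ forall x, I x -> M x.
Proof.
move=> hI.
have [||M [[[Mid M1] IM] Mmax]] := noetherian_max
  (Fam := fun J => Defs.proper_ideal D J /\ forall x, I x -> J x).
- by move=> J [[]].
- by exists I; split.
exists M; split => //; split => // J hJ MJ.
case: (classic (J 1)) => J1; [by left | right].
by apply: Mmax => //; split => // x /IM /MJ.
Qed.

(** * Localization at a maximal ideal *)

Section Maximal.
Variable M : K -> Prop.
Hypothesis maxM : maximal_ideal D M.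

Lemma maximal_isideal : ideal D M. Proof. by case: maxM => [[]]. Qed.
Lemma maximal_not1 : ~ M 1. Proof. by case: maxM => [[]]. Qed.

Lemma maximal_inv x : D x -> ~ M x -> exists y, D y /\ M (1 - y * x).
Proof.
move=> Dx nMx; have hid := maximal_isideal.
case: (maxM) => _ /(_ _ (add_principal_ideal hid Dx) (fun z => @add_principal_sub M x z)).
case=> [[m [r [Mm [Dr e]]]]|h]; last by case: nMx; apply: h; apply: add_principal_mem.
by exists r; split => //; rewrite e addrK.
Qed.

Lemma maximal_prime x y : D x -> D y -> M (x * y) -> M x \/ M y.
Proof.
move=> Dx Dy Mxy; case: (classic (M x)) => Mx; [by left | right].
have [z [Dz Mz]] := maximal_inv Dx Mx.
have -> : y = (1 - z * x) * y + z * (x * y) by ring.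
have hid := maximal_isideal.
by apply: idealD => //; [apply: idealMr | apply: idealM].
Qed.

Lemma maximal_mulN x y : D x -> D y -> ~ M x -> ~ M y -> ~ M (x * y).
Proof. by move=> Dx Dy nx ny /maximal_prime[]. Qed.

(** The local ring of [D] at [M], taken inside [K] so that different [M] can be compared without
    embeddings. *)
Definition loc (z : K) := exists s, D s /\ ~ M s /\ D (s * z).

Lemma loc_D z : D z -> loc z.
Proof. by move=> Dz; exists 1; rewrite mul1r; split; [apply: sr1 | split => //; apply: maximal_not1]. Qed.

Lemma loc_inv s : D s -> ~ M s -> loc s^-1.
Proof.
move=> Ds nMs; exists s; split => //; split => //.
have sn0 : s != 0 by apply/eqP => s0; apply: nMs; rewrite s0; apply: ideal0 maximal_isideal.
by rewrite mulfV //; apply: sr1.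
Qed.

Lemma locM x y : loc x -> loc y -> loc (x * y).
Proof.
move=> [s [Ds [ns sx]]] [t [Dt [nt ty]]]; exists (s * t); split; first exact: srM.
by split; [apply: maximal_mulN | rewrite mulrACA; apply: srM].
Qed.

Lemma locD x y : loc x -> loc y -> loc (x + y).
Proof.
move=> [s [Ds [ns sx]]] [t [Dt [nt ty]]]; exists (s * t); split; first exact: srM.
split; first exact: maximal_mulN.
have -> : s * t * (x + y) = t * (s * x) + s * (t * y) by ring.
by apply: srD; apply: srM.
Qed.

Lemma locN x : loc x -> loc (- x).
Proof. by move=> lx; rewrite -mulN1r; apply: locM => //; apply: loc_D; apply: srN; apply: sr1. Qed.

Lemma locX x n : loc x -> loc (x ^+ n).
Proof.
by move=> lx; elim: n => [|n IH]; [apply: loc_D; apply: sr1 | rewrite exprS; apply: locM].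
Qed.

End Maximal.

(** The denominators of [z] form an ideal; integrality at [M] puts an element outside [M] into it,
    so no maximal ideal contains it. *)
Lemma loc_all z : is_quotient_field D -> (forall M, maximal_ideal D M -> loc M z) -> D z.
Proof.
move=> fracD hz; pose I r := D r /\ D (r * z).
have hI : ideal D I.
  split; first by move=> x [].
  split; first by split; rewrite ?mul0r; apply: sr0.
  split.
    by move=> x y [Dx xz] [Dy yz]; split; rewrite ?mulrDl; apply: srD.
  by move=> r x Dr [Dx xz]; split; rewrite -?mulrA; apply: srM.
case: (classic (I 1)) => [[_]|I1]; first by rewrite mul1r.
have [M [hM IM]] := maximal_above (conj hI I1).
by have [s [Ds [nMs sz]]] := hz M hM; case: nMs; apply: IM.
Qed.

(* [z] is a root of the characteristic polynomial of its action on generators of [I]. *)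
Lemma integral_of_stable I z : ideal D I -> (exists x, I x /\ x != 0) ->
  (forall x, I x -> I (z * x)) -> D z.
Proof.
move=> hI [x0 [Ix0 x0n0]] zI; have [s [sD sI]] := noethD hI.
pose n := size s.
have hA (i : 'I_n) : {r : 'I_n -> K | (forall j, D (r j)) /\ z * s`_i = \sum_(j < n) r j * s`_j}.
  by apply: constructive_indefinite_description; apply/sI; apply: zI; apply: (generator_mem sI).
pose A : 'M[K]_n := \matrix_(j, i) sval (hA i) j.
apply: (closedD (p := char_poly A)).
- exact: char_poly_monic.
- move=> i.
  suff: coef_in D (char_poly A) by apply.
  rewrite /char_poly /determinant => k; rewrite coef_sum; apply: sr_sum => g _.
  apply: coef_inM => //.
    rewrite -polyC1 -polyCN -polyC_exp; apply: coef_inC => //.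
    by apply: srX; apply: srN; apply: sr1.
  apply: coef_in_prod => // j _; rewrite !mxE; apply: coef_inB => //.
    by case: (j == g j) => /=; [apply: coef_inX | apply: coef_in0].
  by apply: coef_inC => //; case: (svalP (hA (g j))) => h _; apply: h.
(* The row of generators is an eigenvector of [A] for [z], non-zero because [I] is. *)
- rewrite -eigenvalue_root_char; apply/eigenvalueP; exists (\row_j s`_j).
    apply/rowP => i; rewrite !mxE; case: (svalP (hA i)) => _ ->.
    by apply: eq_bigr => j _; rewrite !mxE mulrC.
  apply: contra_neq x0n0 => s0.
  have /sI [r [_ ->]] := Ix0; apply: big1 => j _.
  by have := congr1 (fun v : 'rV_n => v 0 j) s0; rewrite !mxE => ->; rewrite mulr0.
Qed.

(* Localised at [M], the quotient ideal [(a : b)] is prime when maximal among proper ones, hence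
   equals [M]; so [b / a] maps [M] into the local ring, and after clearing denominators integral
   closure forbids that it stabilises [M]. *)
Lemma maximal_uniformizer M : maximal_ideal D M -> (exists x, M x /\ x != 0) ->
  exists t pi, M pi /\ D (t * pi) /\ ~ M (t * pi) /\ forall x, M x -> D (t * x).
Proof.
move=> maxM [a [Ma an0]]; have idM := maximal_isideal maxM.
have Da : D a by apply: ideal_D Ma.
pose N b r := D r /\ loc M (r * b / a).
have Nid b : D b -> ideal D (N b).
  move=> Db; split; first by move=> x [].
  split; first by split; rewrite ?mul0r; [apply: sr0 | apply: loc_D => //; apply: sr0].
  split.
    move=> x y [Dx lx] [Dy ly]; split; first exact: srD.
    by rewrite mulrDl mulrDl; apply: locD.
  move=> r x Dr [Dx lx]; split; first exact: srM.
  by rewrite -!mulrA; apply: locM => //; [apply: loc_D | rewrite mulrA].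
have N1 b : N b 1 -> loc M (b / a) by case=> _; rewrite mul1r.
have [||J [[b [Db [nlb ->]]] maxJ]] := noetherian_max
  (Fam := fun J => exists b, D b /\ ~ loc M (b / a) /\ J = N b).
- by move=> J [b [Db [_ ->]]]; apply: Nid.
- exists (N 1), 1; split; first exact: sr1.
  split => // -[s [Ds [nMs h]]]; apply: nMs.
  have -> : s = s * (1 / a) * a by field.
  by apply: idealM.
have primeN : prime_ideal D (N b).
  split; first by split; [apply: Nid | move/N1].
  move=> x y Dx Dy [_ lxy]; case: (classic (N b y)) => Ny; [by right | left].
  (* As [y] is outside [N b], the element [b * y] is admissible too, so the larger ideal [N (b * y)]
     collapses to [N b]. *)
  apply: (maxJ (N (b * y))).
  - exists (b * y); split; [exact: srM | split => // h; apply: Ny; split => //].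
    by rewrite [y * b]mulrC.
  - move=> z [Dz lz]; split => //.
    have -> : z * (b * y) / a = y * (z * b / a) by ring.
    by apply: locM => //; apply: loc_D.
  - by split => //; have -> : x * (b * y) / a = x * y * b / a by ring.
have maxN : maximal_ideal D (N b).
  apply: dimD => //; exists a; split => //; split => //.
  by rewrite mulrAC mulfV // mul1r; apply: loc_D.
(* First [N b] lies in [M]: a member outside [M] would be a local unit and make [b / a] local.
   Maximality of [N b] then reverses the inclusion. *)
have MN x : M x -> N b x.
  case: maxN => _ /(_ M idM) [|/(maximal_not1 maxM)//|h]; last exact: h.
  move=> r [Dr lr]; apply: NNPP => nMr; apply: nlb.
  have rn0 : r != 0 by apply/eqP => r0; apply: nMr; rewrite r0; apply: ideal0.
  have -> : b / a = r^-1 * (r * b / a) by field; rewrite an0.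
  by apply: locM => //; apply: loc_inv.
have [g [gD gM]] := noethD idM.
have den (i : 'I_(size g)) : {s | D s /\ ~ M s /\ D (s * (g`_i * b / a))}.
  by apply: constructive_indefinite_description; case: (MN _ (generator_mem gM i)).
(* A common denominator, still outside [M], for the multiples of [b / a] by the generators of
   [M]. *)
pose s := \prod_(i < size g) sval (den i).
have [Ds nMs] : D s /\ ~ M s.
  rewrite /s; elim/big_rec: _ => [|i x _ [Dx nx]]; first by split; [apply: sr1 | apply: maximal_not1].
  by case: (svalP (den i)) => h1 [h2 _]; split; [apply: srM | apply: maximal_mulN].
pose t := s * (b / a).
have tM x : M x -> D (t * x).
  move=> /gM [r [rD ->]]; rewrite mulr_sumr; apply: sr_sum => i _.
  rewrite /t /s (bigD1 i) //=; case: (svalP (den i)) => h1 [h2 h3].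
  set q := \prod_(j < _ | _) _.
  have -> : sval (den i) * q * (b / a) * (r i * g`_i) =
            q * r i * (sval (den i) * (g`_i * b / a)) by ring.
  apply: srM => //; apply: srM => //; apply: sr_prod => j _.
  by case: (svalP (den j)).
suff [pi [Mpi nMpi]] : exists pi, M pi /\ ~ M (t * pi).
  by exists t, pi; split => //; split; first exact: tM.
(* If [t] mapped [M] into itself, it would be integral, hence in [D], and [b / a] would be local. *)
apply: NNPP => hno; apply: nlb.
have sn0 : s != 0 by apply/eqP => s0; apply: nMs; rewrite s0; apply: ideal0.
have -> : b / a = s^-1 * t by rewrite /t; field; rewrite an0.
apply: locM => //; first exact: loc_inv.
apply: loc_D => //; apply: (integral_of_stable idM); first by exists a.
by move=> x Mx; apply: NNPP => nMx; apply: hno; exists x.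
Qed.

(* Elementwise form of the product of the ideals [Ps] being contained in [I]; the choice [f] depends on the
   ideal only, so repeated ideals contribute powers of one element. *)
Definition covers (Ps : seq (K -> Prop)) (I : K -> Prop) :=
  forall f : (K -> Prop) -> K, (forall P, List.In P Ps -> P (f P)) -> I (\prod_(P <- Ps) f P).

(** A maximal counterexample [J] is not prime, since non-zero primes are maximal. If [x * y] is in
    [J] but neither factor is, the lists obtained for [J + (x)] and [J + (y)] concatenate to one for
    [J]. *)
Lemma maximal_product I : ideal D I -> (exists x, I x /\ x != 0) ->
  exists Ps, (forall P, List.In P Ps -> maximal_ideal D P) /\ covers Ps I.
Proof.
move=> hI I0; apply: NNPP => hno.
pose good I := exists Ps, (forall P, List.In P Ps -> maximal_ideal D P) /\ covers Ps I.
have [||J [[hJ [J0 badJ]] maxJ]] := noetherian_max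
  (Fam := fun J => ideal D J /\ (exists x, J x /\ x != 0) /\ ~ good J).
- by move=> J [].
- by exists I.
have J1 : ~ J 1.
  by move=> J1; apply: badJ; exists [::]; split => // f _; rewrite big_nil.
have bigger x : D x -> ~ J x -> good (add_principal J x).
  move=> Dx nJx; apply: NNPP => bad; apply: nJx.
  apply: (maxJ (add_principal J x)); last exact: add_principal_mem.
    split; first exact: add_principal_ideal.
    by split => //; case: J0 => y [Jy yn0]; exists y; split => //; apply: add_principal_sub.
  by move=> y; apply: add_principal_sub.
case: (classic (prime_ideal D J)) => primeJ.
  apply: badJ; exists [:: J]; split; first by move=> P [<-|//]; apply: dimD.
  by move=> f hf; rewrite big_seq1; apply: hf; left.
apply: primeJ; split => // x y Dx Dy Jxy.
case: (classic (J x)) => Jx; [by left | right].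
apply: NNPP => Jy; apply: badJ.
have [Ps [maxP covP]] := bigger x Dx Jx; have [Qs [maxQ covQ]] := bigger y Dy Jy.
exists (Ps ++ Qs); split.
  by move=> P /List.in_app_iff [/maxP|/maxQ].
move=> f hf; rewrite big_cat /=.
have [i [r [Ji [Dr ->]]]] : add_principal J x (\prod_(P <- Ps) f P).
  by apply: covP => P hP; apply: hf; apply/List.in_app_iff; left.
have [j [s [Jj [Ds ->]]]] : add_principal J y (\prod_(P <- Qs) f P).
  by apply: covQ => P hP; apply: hf; apply/List.in_app_iff; right.
have -> : (i + r * x) * (j + s * y) = (j + s * y) * i + r * x * j + r * s * (x * y) by ring.
have DJj : D j by apply: ideal_D Jj.
apply: idealD => //; first apply: idealD => //; apply: idealM => //; try exact: srM.
by apply: srD => //; apply: srM.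
Qed.

(** From a maximal ideal other than [M] choose an element outside [M], and from [M] itself choose
    [pi]. The product is a power of [pi] times an element outside [M], and the power is trivial when
    [M] does not occur. *)
Lemma covers_local M Ps pi I : maximal_ideal D M -> M pi -> ideal D I ->
  (forall P, List.In P Ps -> maximal_ideal D P) -> covers Ps I ->
  (exists u, D u /\ ~ M u /\ I (pi ^+ size Ps * u)) /\
  ((forall P, List.In P Ps -> ~ (forall x, M x <-> P x)) -> exists u, ~ M u /\ I u).
Proof.
move=> maxM Mpi hI maxP cov; have idM := maximal_isideal maxM.
have Dpi : D pi by apply: ideal_D Mpi.
have ex P : maximal_ideal D P -> {p | P p /\ ((~ M p) \/ (p = pi /\ forall x, M x <-> P x))}.
  move=> hP; apply: constructive_indefinite_description.
  case: (classic (exists p, P p /\ ~ M p)) => [[p [Pp nMp]]|hno]; first by exists p; split => //; left.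
  have PM x : P x -> M x by move=> Px; apply: NNPP => nMx; apply: hno; exists x.
  have MP x : M x -> P x.
    by case: (hP) => _ /(_ M idM PM) [/(maximal_not1 maxM)//|]; apply.
  exists pi; split; first exact: MP.
  by right; split => // x; split; [apply: MP | apply: PM].
pose f P := match excluded_middle_informative (maximal_ideal D P) with
            | left h => sval (ex P h) | right _ => 0 end.
have fP P : List.In P Ps -> P (f P) /\ ((~ M (f P)) \/ (f P = pi /\ forall x, M x <-> P x)).
  move=> /maxP hP; rewrite /f; case: excluded_middle_informative => // h.
  exact: svalP (ex P h).
have covf : I (\prod_(P <- Ps) f P) by apply: cov => P /fP [].
(* Here [j] counts the occurrences of [M] in [Ps]. *)
have [j [u [jle [Du [nMu [e hj]]]]]] : exists j u, (j <= size Ps)%N /\ D u /\ ~ M u /\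
    \prod_(P <- Ps) f P = pi ^+ j * u /\
    ((forall P, List.In P Ps -> ~ (forall x, M x <-> P x)) -> j = 0%N).
  elim: Ps maxP fP {cov covf} => [|P Ps IH] maxP fP.
    exists 0%N, 1; split => //; split; first exact: sr1.
    by split; [apply: maximal_not1 | rewrite big_nil mul1r].
  have [||j [u [jle [Du [nMu [e hj]]]]]] := IH.
  - by move=> Q hQ; apply: maxP; right.
  - by move=> Q hQ; apply: fP; right.
  have inP : List.In P (P :: Ps) by left.
  have DfP : D (f P) by apply: (ideal_D (maximal_isideal (maxP P inP))); case: (fP P inP).
  case: (fP P inP) => _ [nMf|[fpi eqP]].
    exists j, (f P * u); split; first exact: leqW.
    split; first exact: srM; split; first exact: maximal_mulN.
    split; first by rewrite big_cons e; ring.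
    by move=> h; apply: hj => Q hQ; apply: h; right.
  exists j.+1, u; do 3?[split=> //]; split; first by rewrite big_cons e fpi exprS mulrA.
  by move=> /(_ P inP).
split; last by move=> /hj j0; exists u; split => //; move: covf; rewrite e j0 mul1r.
exists u; split => //; split => //.
rewrite -(subnK jle) exprD -mulrA -e; apply: idealM => //.
exact: srX.
Qed.

(** * Integer-valued polynomials with prescribed divisibility *)

Lemma int_valued_prod (I : Type) (r : seq I) (F : I -> {poly K}) :
  (forall i, int_valued D (F i)) -> int_valued D (\prod_(i <- r) F i).
Proof. by move=> h d Dd; rewrite horner_prod; apply: sr_prod => i _; apply: h. Qed.

Section LocalPolynomial.
Variables (M : K -> Prop) (t pi : K).
Hypotheses (maxM : maximal_ideal D M) (finM : finite_index D M).
Hypotheses (Dtpi : D (t * pi)) (nMtpi : ~ M (t * pi)).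
Hypothesis DtM : forall x, M x -> D (t * x).

Let idM := maximal_isideal maxM.

(** The product of the [X - s], with [s] running over representatives of the non-zero residue
    classes, vanishes modulo [M] off [M] and is a unit modulo [M] at 0. Scaling it and adding a
    constant from [M] makes the value at 0 exactly 1. *)
Lemma separating_poly : exists g : {poly K}, coef_in D g /\ g.[0] = 1 /\
  forall x, D x -> ~ M x -> M g.[x].
Proof.
have [s hs] := finM.
pose ok z := D z /\ ~ M z.
(* Entries of [s] in [M] or outside [D] are replaced by 1, so that no root lies in [M]. *)
pose s' (j : 'I_(size s)) := if excluded_middle_informative (ok s`_j) then s`_j else 1.
have ok1 : ok 1 by split; [apply: sr1 | apply: maximal_not1].
have oks' j : ok (s' j) by rewrite /s'; case: excluded_middle_informative.
pose p := \prod_(j < size s) ('X - (s' j)%:P).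
have Dp : coef_in D p.
  apply: coef_in_prod => // j _; apply: coef_inB => //; first exact: coef_inX.
  by apply: coef_inC => //; case: (oks' j).
have Dp0 : D p.[0] by apply: coef_in_horner => //; apply: sr0.
have np0 : ~ M p.[0].
  rewrite /p horner_prod.
  suff : ok (\prod_(j < size s) ('X - (s' j)%:P).[0]) by case.
  elim/big_rec: _ => // j x _ [Dx nx]; rewrite hornerXsubC sub0r mulNr.
  case: (oks' j) => h1 h2; split; first by apply: srN; apply: srM.
  by move=> /(idealN idM); rewrite opprK; apply: maximal_mulN.
have [y [Dy My]] := maximal_inv maxM Dp0 np0.
exists (y *: p + (1 - y * p.[0])%:P); split.
  apply: coef_inD => //; first exact: coef_inZ.
  by apply: coef_inC => //; apply: ideal_D My.
split; first by rewrite hornerD hornerZ hornerC addrC subrK.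
move=> x Dx nMx; rewrite hornerD hornerZ hornerC; apply: idealD => //; apply: idealM => //.
have [i ilt Mi] := hs x Dx; pose j := Ordinal ilt.
have es : s`_i = x - (x - s`_i) by rewrite opprB addrC subrK.
have okj : ok s`_j.
  split; first by rewrite /= es; apply: srB => //; apply: ideal_D Mi.
  move=> /= Ms; apply: nMx; have -> : x = (x - s`_i) + s`_i by rewrite subrK.
  exact: idealD.
rewrite /p horner_prod (bigD1 j) //=; apply: idealMr => //.
  apply: sr_prod => k _; rewrite hornerXsubC; apply: srB => //.
  by case: (oks' k).
by rewrite hornerXsubC /s'; case: excluded_middle_informative.
Qed.

(* Elements whose denominators involve no maximal ideal other than [M]. *)
Definition away (z : K) := exists k, forall m, M m -> D (m ^+ k * z).

Lemma away_subring : is_subring away.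
Proof.
split; first by exists 0%N => m _; rewrite mulr1; apply: sr1.
split=> x y [k hk] [l hl]; exists (k + l)%N => m Mm; have Dm := ideal_D idM Mm.
  have -> : m ^+ (k + l) * (x - y) = m ^+ l * (m ^+ k * x) - m ^+ k * (m ^+ l * y).
    by rewrite exprD; ring.
  by apply: srB; apply: srM; (apply: srX || apply: hk || apply: hl).
by rewrite exprD mulrACA; apply: srM; [apply: hk | apply: hl].
Qed.

Lemma away_D z : D z -> away z.
Proof. by move=> Dz; exists 0%N => m _; rewrite mul1r. Qed.

(** One exponent serves all [m] and [x], so a fixed power of the separating polynomial can clear the
    denominators. *)
Lemma away_horner p : coef_in away p ->
  exists k, forall m x, M m -> D x -> D (m ^+ k * p.[x]).
Proof.
elim/poly_ind: p => [|p a IH] hp.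
  by exists 0%N => m x _ _; rewrite horner0 mulr0; apply: sr0.
have [|k hk] := IH; first by move=> i; have := hp i.+1; rewrite coefD coefMX coefC /= addr0.
have [l hl] : away a by have := hp 0%N; rewrite coefD coefMX coefC /= add0r.
exists (k + l)%N => m x Mm Dx; have Dm := ideal_D idM Mm.
rewrite !hornerE.
have -> : m ^+ (k + l) * (p.[x] * x + a) = m ^+ l * x * (m ^+ k * p.[x]) + m ^+ k * (m ^+ l * a).
  by rewrite exprD; ring.
apply: srD; apply: srM; try exact: srX; try exact: hk; try exact: hl.
by apply: srM => //; apply: srX.
Qed.

(* Induction on [e]: substituting [t * x] gains one factor of [pi] on [M]; off [M] a high power
   of a polynomial vanishing modulo [M] there absorbs the denominators of [t]. *)
Lemma local_poly e : exists f : {poly K}, coef_in away f /\ f.[0] = 1 /\ int_valued D f /\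
  forall x, D x -> loc M (x * f.[x] / pi ^+ e).
Proof.
have [g [Dg [g0 gM]]] := separating_poly.
have tpin0 : t * pi != 0 by apply/eqP => h; apply: nMtpi; rewrite h; apply: ideal0.
have [tn0 pin0] : t != 0 /\ pi != 0 by apply/andP; rewrite -negb_or -mulf_eq0.
have ltpi := loc_inv maxM Dtpi nMtpi.
elim: e => [|e [f [af [f0 [If lf]]]]].
  exists 1; split.
    by rewrite -polyC1; apply: coef_inC; [apply: away_subring | apply: away_D; apply: sr1].
  split; first by rewrite hornerC.
  split; first by move=> x _; rewrite hornerC; apply: sr1.
  by move=> x Dx; rewrite hornerC divr1 mulr1; apply: loc_D.
pose h := f \Po (t *: 'X).
have hE x : h.[x] = f.[t * x] by rewrite horner_comp hornerZ hornerX.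
have ah : coef_in away h.
  apply: coef_in_comp => //; first exact: away_subring.
  apply: coef_inZ; [exact: away_subring | by exists 1%N => m Mm; rewrite mulrC; apply: DtM |].
  by apply: coef_inX; apply: away_subring.
have [k hk] := away_horner ah.
have Igx x : D x -> D g.[x] by move=> Dx; apply: coef_in_horner.
(* Off [M], [k] factors [g] clear the denominators of [h] and the other [e.+1] compensate for
   [pi ^+ e.+1]. *)
pose L := (e.+1 + k)%N.
have off x : D x -> ~ M x -> exists2 m, M m & exists2 d, D d & (g ^+ L * h).[x] = m ^+ e.+1 * d.
  move=> Dx nMx; exists g.[x]; first exact: gM.
  exists (g.[x] ^+ k * h.[x]); first by apply: hk => //; apply: gM.
  by rewrite hornerM horner_exp exprD mulrA.
exists (g ^+ L * h); split.
  apply: coef_inM => //; first exact: away_subring.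
  by apply: coef_inXn => [|i]; [apply: away_subring | apply: away_D].
split; first by rewrite hornerM horner_exp g0 expr1n mul1r hE mulr0.
split=> x Dx; case: (classic (M x)) => Mx.
- rewrite hornerM horner_exp hE; apply: srM; first by apply: srX; apply: Igx.
  by apply: If; apply: DtM.
- have [m Mm [d Dd ->]] := off x Dx Mx.
  by apply: srM => //; apply: srX; apply: ideal_D Mm.
- have -> : x * (g ^+ L * h).[x] / pi ^+ e.+1 =
            g.[x] ^+ L * (t * pi)^-1 * (t * x * f.[t * x] / pi ^+ e).
    by rewrite hornerM horner_exp hE exprS; field; rewrite expf_neq0 ?pin0 ?tn0.
  apply: locM => //; last by apply: lf; apply: DtM.
  by apply: locM => //; apply: loc_D => //; apply: srX; apply: Igx.
have [m Mm [d Dd ->]] := off x Dx Mx.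
(* The quotient [m / pi] is local, being [t * m] over the local unit [t * pi]. *)
have -> : x * (m ^+ e.+1 * d) / pi ^+ e.+1 = x * d * (t * m * (t * pi)^-1) ^+ e.+1.
  rewrite -mulf_div divff // mul1r expr_div_n.
  by field; rewrite expf_neq0.
apply: locM => //; first by apply: loc_D => //; apply: srM.
by apply: locX => //; apply: locM => //; apply: loc_D => //; apply: DtM.
Qed.

End LocalPolynomial.

(** * Gluing the local polynomials into one with a fixed divisor *)

Section Construction.
Hypothesis fracD : is_quotient_field D.
Hypothesis maximal_neq0 : forall M, maximal_ideal D M -> exists x, M x /\ x != 0.
Hypothesis finD : forall M, maximal_ideal D M -> finite_index D M.

(** Divisibility by [c] is checked locally. At a member of [Ps] the corresponding factor contributes
    a power of [pi] that [c] divides locally; at any other maximal ideal [c] is a local unit. *)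
Lemma fixed_divisor_poly c : D c -> c != 0 ->
  exists F : {poly K}, int_valued D F /\ F.[0] = 1 /\ forall x, D x -> D (x * F.[x] / c).
Proof.
move=> Dc cn0; have idc := principal_ideal Dc.
have [|Ps [maxP covP]] := maximal_product idc; first by exists c; split => //; apply: principal_mem.
have ex P : maximal_ideal D P -> {f : {poly K} | int_valued D f /\ f.[0] = 1 /\
    exists pi, P pi /\ pi != 0 /\ forall x, D x -> loc P (x * f.[x] / pi ^+ size Ps)}.
  move=> hP; apply: constructive_indefinite_description.
  have [t [pi [Ppi [Dt [nt tP]]]]] := maximal_uniformizer hP (maximal_neq0 hP).
  have [f [_ [f0 [If lf]]]] := local_poly hP (finD hP) Dt nt tP (size Ps).
  exists f; split => //; split => //; exists pi; split => //; split => //.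
  by apply/eqP => pi0; apply: nt; rewrite pi0 mulr0; apply: ideal0; apply: maximal_isideal.
pose f P := match excluded_middle_informative (maximal_ideal D P) with
            | left h => sval (ex P h) | right _ => 1 end.
have fP P : maximal_ideal D P -> exists pi, P pi /\ pi != 0 /\
    forall x, D x -> loc P (x * (f P).[x] / pi ^+ size Ps).
  move=> hP; rewrite /f; case: excluded_middle_informative => // h.
  by case: (svalP (ex P h)) => _ [].
have If P : int_valued D (f P) /\ (f P).[0] = 1.
  rewrite /f; case: excluded_middle_informative => h; first by case: (svalP (ex P h)) => ? [].
  by split=> [x _|]; rewrite hornerC //; apply: sr1.
have Iprod Qs : int_valued D (\prod_(P <- Qs) f P).
  by apply: int_valued_prod => P; case: (If P).
exists (\prod_(P <- Ps) f P); split => //; split.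
  by rewrite horner_prod big1 // => P _; case: (If P).
move=> x Dx; apply: loc_all => // M maxM.
case: (classic (exists P, List.In P Ps /\ forall x, M x <-> P x)) => [[P [inP MP]]|hno].
  have hP := maxP P inP.
  suff [s [Ds [nPs Ds']]] : loc P (x * (\prod_(P <- Ps) f P).[x] / c).
    by exists s; split => //; split => // Ms; apply: nPs; apply/MP.
  have [pi [Ppi [pin0 lf]]] := fP P hP.
  have [[u [Du [nPu [r [Dr e]]]]] _] := covers_local hP Ppi idc maxP covP.
  have un0 : u != 0 by apply/eqP => u0; apply: nPu; rewrite u0; apply: ideal0; apply: maximal_isideal.
  set k := size Ps in lf e.
  have [As [Bs eP]] := List.in_split _ _ inP.
  have -> : \prod_(P <- Ps) f P = f P * (\prod_(P <- As ++ Bs) f P).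
    by rewrite eP !big_cat big_cons /= mulrCA.
  set R := \prod_(_ <- _) _.
  have -> : x * (f P * R).[x] / c = (x * (f P).[x] / pi ^+ k) * (r * u^-1 * R.[x]).
    have -> : r = pi ^+ k * u / c by rewrite e mulfK.
    by rewrite hornerM; field; rewrite expf_neq0 ?un0 ?cn0.
  apply: locM => //; first exact: lf.
  apply: locM => //; last by apply: loc_D => //; apply: Iprod.
  by apply: locM => //; [apply: loc_D | apply: loc_inv].
have [m [Mm _]] := maximal_neq0 maxM.
have [_ [|u [nMu [r [Dr e]]]]] := covers_local maxM Mm idc maxP covP.
  by move=> P inP h; apply: hno; exists P.
have un0 : u != 0 by apply/eqP => u0; apply: nMu; rewrite u0; apply: ideal0; apply: maximal_isideal.
have rn0 : r != 0 by apply: contra_neq un0 => r0; rewrite e r0 mul0r.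
have -> : x * (\prod_(P <- Ps) f P).[x] / c = x * (\prod_(P <- Ps) f P).[x] * (r * u^-1).
  by rewrite e; field; rewrite cn0.
apply: locM => //; first by apply: loc_D => //; apply: srM => //; apply: Iprod.
have Du : D u by rewrite e; apply: srM.
by apply: locM => //; [apply: loc_D | apply: loc_inv].
Qed.

(* For [F] adapted to [c^2], substituting [x (c - x)] normalises the value at [c]; then
   [z = x F(x (c - x)) / c] is integral, as a root of [z^2 - F z + d F] where
   [d = x (c - x) F / c^2]. *)
Lemma fixed_divisor_poly_one c : D c -> c != 0 ->
  exists F : {poly K}, int_valued D F /\ F.[0] = 1 /\ F.[c] = 1 /\
    forall x, D x -> D (x * F.[x] / c).
Proof.
move=> Dc cn0.
have [||F [IF [F0 hF]]] := @fixed_divisor_poly (c ^+ 2); first exact: srX; first by rewrite expf_neq0.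
pose q : {poly K} := 'X * (c%:P - 'X).
have qE x : q.[x] = x * (c - x) by rewrite hornerM hornerX hornerD hornerN hornerC hornerX.
have qD x : D x -> D q.[x] by move=> Dx; rewrite qE; apply: srM => //; apply: srB.
exists (F \Po q); split; first by move=> x Dx; rewrite horner_comp; apply: IF; apply: qD.
split; first by rewrite horner_comp qE mul0r.
split; first by rewrite horner_comp qE subrr mulr0.
move=> x Dx; rewrite horner_comp.
set v := F.[q.[x]]; have Dv : D v by apply: IF; apply: qD.
have Dd := hF _ (qD x Dx); rewrite -/v in Dd; set d := _ / _ in Dd.
pose p : {poly K} := 'X * ('X - v%:P) + (v * d)%:P.
apply: (closedD (p := p)).
- rewrite monicE lead_coefDl; first by rewrite -monicE monicMr ?monicX // monicXsubC.
  rewrite size_polyC; apply: leq_ltn_trans (leq_b1 _) _.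
  by rewrite mulrC size_mulX ?size_XsubC // polyXsubC_eq0.
- apply: coef_inD => //; last by apply: coef_inC => //; apply: srM.
  apply: coef_inM => //; first exact: coef_inX.
  by apply: coef_inB => //; [apply: coef_inX | apply: coef_inC].
rewrite /root /p hornerD hornerM hornerX hornerXsubC hornerC /d qE; apply/eqP.
by field; rewrite cn0.
Qed.

(** * Irreducibility over the quotient field *)

Section Eisenstein.
Variables (Q : K -> Prop) (t pi : K).
Hypotheses (maxQ : maximal_ideal D Q) (Qpi : Q pi) (Dtpi : D (t * pi)) (nQtpi : ~ Q (t * pi)).
Hypothesis DtQ : forall x, Q x -> D (t * x).

Let idQ := maximal_isideal maxQ.
Let Dpi : D pi. Proof. exact: ideal_D Qpi. Qed.
Let pin0 : pi != 0.
Proof. by apply/eqP => h; apply: nQtpi; rewrite h mulr0; apply: ideal0. Qed.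

Lemma uniformizer_div x : Q x -> loc Q (x / pi).
Proof.
move=> Qx.
have tn0 : t != 0 by apply/eqP => h; apply: nQtpi; rewrite h mul0r; apply: ideal0.
have -> : x / pi = t * x * (t * pi)^-1 by field; rewrite tn0 pin0.
by apply: locM => //; [apply: loc_D => //; apply: DtQ | apply: loc_inv].
Qed.

Lemma loc_uniformizer_inv : ~ loc Q pi^-1.
Proof.
move=> [s [Ds [nQs Dsp]]]; apply: nQs; have -> : s = s / pi * pi by rewrite mulfVK.
exact: idealM.
Qed.

(** A numerator in [Q] is divisible by [pi], and one outside [Q] is a local unit. *)
Lemma loc_nonunit z : loc Q z -> loc Q z^-1 \/ loc Q (z / pi).
Proof.
move=> [s [Ds [nQs Dz]]].
have sn0 : s != 0 by apply/eqP => h; apply: nQs; rewrite h; apply: ideal0.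
case: (classic (Q (s * z))) => Qz; [right | left].
  have -> : z / pi = s^-1 * (s * z / pi) by field; rewrite pin0 sn0.
  by apply: locM => //; [apply: loc_inv | apply: uniformizer_div].
have szn0 : s * z != 0 by apply/eqP => h; apply: Qz; rewrite h; apply: ideal0.
have -> : z^-1 = s * (s * z)^-1.
  by move: szn0; rewrite mulf_eq0 negb_or => /andP[_ zn0]; field; rewrite zn0 sn0.
by apply: locM => //; [apply: loc_D | apply: loc_inv].
Qed.

(** Some power of [pi] is a local multiple of [a], which bounds how often [pi] can be divided out;
    the induction is on that bound. *)
Lemma loc_factor a : D a -> a != 0 ->
  exists k u, loc Q u /\ loc Q u^-1 /\ a = pi ^+ k * u.
Proof.
move=> Da an0; have ida := principal_ideal Da.
have [|Ps [maxP covP]] := maximal_product ida; first by exists a; split => //; apply: principal_mem.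
have [[w [Dw [nQw [r [Dr e]]]]] _] := covers_local maxQ Qpi ida maxP covP.
have wn0 : w != 0 by apply/eqP => h; apply: nQw; rewrite h; apply: ideal0.
have : loc Q (pi ^+ size Ps / a).
  have -> : pi ^+ size Ps / a = r * w^-1.
    by rewrite -(mulfK wn0 (pi ^+ size Ps)) e; field; rewrite wn0 an0.
  by apply: locM => //; [apply: loc_D | apply: loc_inv].
have : loc Q a by apply: loc_D.
elim: (size Ps) a an0 {Da ida maxP covP Dr e} => [|k IH] a an0 la lpa.
  by exists 0%N, a; rewrite mul1r in lpa; rewrite mul1r.
case: (loc_nonunit la) => [lV|lp]; first by exists 0%N, a; rewrite mul1r.
have [|//||j [u [lu [luV e]]]] := IH (a / pi).
- by rewrite mulf_neq0 // invr_eq0.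
- by have -> : pi ^+ k / (a / pi) = pi ^+ k.+1 / a by rewrite exprS; field; rewrite pin0 an0.
by exists j.+1, u; split => //; split => //; rewrite exprS -mulrA -e mulrC mulfVK.
Qed.

(** The local ring is a discrete valuation ring: compare the exponents of [pi] in numerator and
    denominator, equality falling under the second case. *)
Lemma loc_valuation z : z != 0 -> loc Q (z / pi) \/ loc Q z^-1.
Proof.
have [a [b [Da [Db [bn0 ->]]]]] := fracD z; rewrite mulf_eq0 invr_eq0 negb_or => /andP[an0 _].
have [k [u [lu [luV eu]]]] := loc_factor Da an0.
have [l [w [lw [lwV ew]]]] := loc_factor Db bn0.
have lpi n : loc Q (pi ^+ n) by apply: loc_D => //; apply: srX.
have un0 : u != 0 by apply: contra_neq an0 => h; rewrite eu h mulr0.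
have wn0 : w != 0 by apply: contra_neq bn0 => h; rewrite ew h mulr0.
case: (ltnP l k) => hlk; [left | right].
  have -> : a / b / pi = pi ^+ (k - l.+1) * (u * w^-1).
    rewrite eu ew -{1}(subnK hlk) exprD exprS; field.
    by rewrite pin0 wn0 expf_neq0.
  by apply: locM => //; apply: locM.
have -> : (a / b)^-1 = pi ^+ (l - k) * (w * u^-1).
  rewrite eu ew -{1}(subnK hlk) exprD; field.
  by rewrite un0 wn0 ?expf_neq0 ?pin0.
by apply: locM => //; apply: locM.
Qed.

(** The index is the last one of minimal valuation. In the induction a new constant term takes over
    only when its valuation is strictly smaller. *)
Lemma dominant_coef (g : {poly K}) : g != 0 -> exists i, g`_i != 0 /\
  (forall j, loc Q (g`_j / g`_i)) /\ (forall j, (i < j)%N -> loc Q (g`_j / g`_i / pi)).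
Proof.
have l0 : loc Q 0 by apply: loc_D => //; apply: sr0.
have l1 : loc Q 1 by apply: loc_D => //; apply: sr1.
elim/poly_ind: g => [|g a IH] hg; first by rewrite eqxx in hg.
have e0 : (g * 'X + a%:P)`_0 = a by rewrite coefD coefMX coefC add0r.
have eS j : (g * 'X + a%:P)`_j.+1 = g`_j by rewrite coefD coefMX coefC addr0.
have [g0|gn0] := eqVneq g 0.
  have an0 : a != 0 by apply: contra_neq hg => ->; rewrite g0 mul0r add0r.
  exists 0%N; rewrite e0; split => //; split.
    by case=> [|j]; rewrite ?e0 ?eS ?g0 ?coef0 ?mul0r // divff.
  by case=> // j _; rewrite eS g0 coef0 !mul0r.
have [i [gi [h1 h2]]] := IH gn0.
have [a0|an0] := eqVneq a 0.
  exists i.+1; rewrite eS; split => //; split.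
    by case=> [|j]; rewrite ?e0 ?eS ?a0 ?mul0r.
  by case=> // j; rewrite ltnS eS; apply: h2.
have [lp|lV] : loc Q (g`_i / a / pi) \/ loc Q (g`_i / a)^-1.
- by apply: loc_valuation; rewrite mulf_neq0 // invr_eq0.
- exists 0%N; rewrite e0; split => //.
  have h j : loc Q (g`_j / a / pi).
    have -> : g`_j / a / pi = g`_j / g`_i * (g`_i / a / pi) by field; rewrite gi pin0 an0.
    exact: locM.
  split; last by case=> // j _; rewrite eS.
  case=> [|j]; rewrite ?e0 ?eS ?divff //.
  have -> : g`_j / a = pi * (g`_j / a / pi) by field; rewrite pin0 an0.
  by apply: locM => //; apply: loc_D.
exists i.+1; rewrite eS; split => //; split.
  case=> [|j]; rewrite ?e0 ?eS //.
  by have -> : a / g`_i = (g`_i / a)^-1 by rewrite invf_div.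
by case=> // j; rewrite ltnS eS; apply: h2.
Qed.

(* Eisenstein for the reversed polynomial. The last coefficients of minimal valuation of the two
   factors multiply to one of [p], so both are constant coefficients, and then the leading
   coefficient of [p] would be divisible by [pi ^ 2]. *)
Lemma eisenstein (p g h : {poly K}) c : p`_0 = 1 -> (forall i, loc Q (p`_i.+1 / pi)) ->
  lead_coef p = pi * c -> loc Q c^-1 -> p = g * h -> (size g <= 1)%N \/ (size h <= 1)%N.
Proof.
move=> p0 hp lp lc e.
have pn0 : p != 0 by apply/eqP => h0; move: p0; rewrite h0 coef0 => /eqP; rewrite eq_sym oner_eq0.
have cn0 : c != 0.
  by apply: contra_neq pn0 => c0; apply/eqP; rewrite -lead_coef_eq0 lp c0 mulr0.
move: (pn0); rewrite e mulf_eq0 negb_or => /andP[gn0 hn0].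
have [i [gi [g1 g2]]] := dominant_coef gn0; have [k [hk [h1 h2]]] := dominant_coef hn0.
have gh0 : g`_0 * h`_0 = 1 by rewrite -p0 e coefM big_ord_recl big_ord0 addr0.
have lV : loc Q (g`_i * h`_k)^-1.
  have -> : (g`_i * h`_k)^-1 = g`_0 / g`_i * (h`_0 / h`_k).
    by rewrite mulf_div gh0 mul1r.
  exact: locM.
(* For [i + k > 0], the coefficient of [p] at [i + k] is divisible by [pi], yet divided by the
   product of the dominant coefficients it is 1 plus terms divisible by [pi]. *)
have [/eqP|ik] := posnP (i + k); last first.
  case: loc_uniformizer_inv.
  have lq : loc Q (p`_(i + k) / pi * (g`_i * h`_k)^-1).
    by apply: locM => //; rewrite -(prednK ik).
  have -> : pi^-1 = p`_(i + k) / pi * (g`_i * h`_k)^-1 -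
      \sum_(j < (i + k).+1 | j != i :> nat) g`_j / g`_i * (h`_(i + k - j) / h`_k) / pi.
    have ilt : (i < (i + k).+1)%N by rewrite ltnS leq_addr.
    rewrite e coefM (bigD1 (Ordinal ilt)) //= addKn.
    have -> : \sum_(j < (i + k).+1 | j != i :> nat) g`_j / g`_i * (h`_(i + k - j) / h`_k) / pi
        = (\sum_(j < (i + k).+1 | j != Ordinal ilt) g`_j * h`_(i + k - j)) / pi * (g`_i * h`_k)^-1.
      rewrite !mulr_suml; apply: eq_big => // j _.
      by field; rewrite gi hk pin0.
    by field; rewrite gi hk pin0.
  apply: locD => //; apply: locN => //; elim/big_rec: _ => [|j x ji lx].
    by apply: loc_D => //; apply: sr0.
  apply: locD => //; case: (ltnP i j) => hij.
    by rewrite mulrAC; apply: locM => //; apply: g2.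
  rewrite -mulrA; apply: locM => //; apply: h2.
  have ltji : (j < i)%N by rewrite ltn_neqAle ji hij.
  by rewrite ltn_subRL ltn_add2r.
rewrite addn_eq0 => /andP[/eqP i0 /eqP k0]; subst i k.
case: (leqP (size g) 1) => sg; first by left.
case: (leqP (size h) 1) => sh; first by right.
case: loc_uniformizer_inv.
have -> : pi^-1 = c^-1 * (lead_coef g / g`_0 / pi * (lead_coef h / h`_0 / pi)).
  have el : lead_coef g * lead_coef h = pi * c by rewrite -lead_coefM -e.
  have -> : lead_coef g / g`_0 / pi * (lead_coef h / h`_0 / pi) =
      (lead_coef g * lead_coef h) / (g`_0 * h`_0) / pi / pi.
    by field; rewrite gi hk pin0.
  by rewrite gh0 el divr1; field; rewrite cn0 pin0.
apply: locM => //; apply: locM => //.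
  by apply: g2; rewrite -subn1 subn_gt0.
by apply: h2; rewrite -subn1 subn_gt0.
Qed.

End Eisenstein.

(** * Irreducible polynomials with a fixed divisor *)

Lemma common_denominator (p : {poly K}) : exists d, D d /\ d != 0 /\ coef_in D (d *: p).
Proof.
elim/poly_ind: p => [|p a [d [Dd [dn0 hd]]]].
  by exists 1; rewrite scaler0 oner_eq0; split; [apply: sr1 | split => //; apply: coef_in0].
have [n [b [Dn [Db [bn0 ->]]]]] := fracD a.
exists (d * b); split; first exact: srM; split; first by rewrite mulf_neq0.
case=> [|i]; rewrite coefZ coefD coefMX coefC /=.
  have -> : d * b * (0 + n / b) = d * n by field; rewrite bn0.
  exact: srM.
by rewrite addr0 mulrAC -coefZ; apply: srM.
Qed.

Hypothesis infD : infinitely_many_maximal_ideals D.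

(** Every maximal ideal containing [c] occurs in any product of maximal ideals that lies in the
    ideal of [c], so there are finitely many. *)
Lemma maximal_avoiding c : D c -> c != 0 -> exists Q, maximal_ideal D Q /\ ~ Q c.
Proof.
move=> Dc cn0; have idc := principal_ideal Dc.
have [|Ps [maxP covP]] := maximal_product idc; first by exists c; split => //; apply: principal_mem.
have [Q [maxQ hQ]] := infD (fun i : 'I_(size Ps) => nth (fun _ => False) Ps i).
exists Q; split => // Qc.
have [_ [|u [nQu [r [Dr e]]]]] := covers_local maxQ Qc idc maxP covP.
  move=> P inP eqP.
  suff [i ei] : exists i : 'I_(size Ps), P = nth (fun _ => False) Ps i.
    by apply: (hQ i); rewrite -ei.
  elim: Ps inP {maxP covP hQ} => //= R Ps IH [<-|/IH [i ->]].
    by exists ord0.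
  by exists (lift ord0 i).
by apply: nQu; rewrite e; apply: idealM => //; apply: maximal_isideal.
Qed.

(** The polynomial [F] is perturbed by means of an [e] that is 1 modulo [c] and 0 modulo [Q]: the
    former keeps [x H] divisible by [c], the latter makes the non-constant coefficients divisible by
    [pi] locally at [Q]. *)
Lemma irreducible_fixed_divisor_poly c : D c -> c != 0 ->
  exists H : {poly K}, int_valued D H /\ H.[0] = 1 /\ H.[c] = 1 /\
    (forall x, D x -> D (x * H.[x] / c)) /\ (1 < size H)%N /\
    forall g h, H = g * h -> (size g <= 1)%N \/ (size h <= 1)%N.
Proof.
move=> Dc cn0; have [F [IF [F0 [Fc hF]]]] := fixed_divisor_poly_one Dc cn0.
have [d [Dd [dn0 hd]]] := common_denominator F.
(* Avoiding [d] makes the coefficients of [F] local at [Q]; avoiding [c] makes [c] a local unit and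
   [e] available. *)
have [|Q [maxQ nQcd]] := maximal_avoiding (srM Dc Dd); first by rewrite mulf_neq0.
have idQ := maximal_isideal maxQ.
have nQc : ~ Q c by move=> Qc; apply: nQcd; apply: idealMr.
have nQd : ~ Q d by move=> Qd; apply: nQcd; apply: idealM.
have [t [pi [Qpi [Dt [nt tQ]]]]] := maximal_uniformizer maxQ (maximal_neq0 maxQ).
have Dpi : D pi by apply: ideal_D Qpi.
have pin0 : pi != 0 by apply/eqP => h; apply: nt; rewrite h mulr0; apply: ideal0.
have [y [Dy Qe]] := maximal_inv maxQ Dc nQc; set e := 1 - y * c in Qe.
have De : D e by apply: ideal_D Qe.
(* [B] vanishes at 0 and [c], which preserves both values, and has larger degree than [F], so the
   leading coefficient of [H] will be [pi * c]. *)
pose B : {poly K} := 'X^((size F).+1) * ('X - c%:P).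
have DB : coef_in D B.
  apply: coef_inM => //; first by apply: coef_inXn => //; apply: coef_inX.
  by apply: coef_inB => //; [apply: coef_inX | apply: coef_inC].
have BE x : B.[x] = x ^+ (size F).+1 * (x - c) by rewrite hornerM hornerXn hornerXsubC.
pose A : {poly K} := 1 + e *: (F - 1).
pose H := A + (pi * c) *: B.
have HE x : H.[x] = 1 + e * (F.[x] - 1) + pi * c * (x ^+ (size F).+1 * (x - c)).
  by rewrite hornerD hornerZ BE /A hornerD hornerZ hornerD hornerN hornerC.
have pcn0 : pi * c != 0 by rewrite mulf_neq0.
have Bmonic : B \is monic by rewrite monicMr ?monicXn // monicXsubC.
have sB : size ((pi * c) *: B) = (size F).+3.
  rewrite size_scale // /B mulrC size_mulXn ?polyXsubC_eq0 // size_XsubC.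
  by rewrite addnC.
have sAB : (size A < size ((pi * c) *: B))%N.
  rewrite sB ltnS; apply: leq_trans (size_polyD _ _) _; rewrite geq_max size_poly1 /=.
  apply: leq_trans (size_scale_leq _ _) _; apply: leq_trans (size_polyD _ _) _.
  by rewrite size_polyN size_poly1 geq_max andbT; apply: leqW; apply: leqW.
have H0 : H.[0] = 1 by rewrite HE F0 exprS mul0r subrr !(mulr0, mul0r, addr0).
have lead : lead_coef H = pi * c by rewrite lead_coefDr // lead_coefZ (monicP Bmonic) mulr1.
exists H; split.
  move=> x Dx; rewrite HE; apply: srD; last first.
    by apply: srM; [apply: srM | apply: srM; [apply: srX | apply: srB]].
  apply: srD; first exact: sr1.
  by apply: srM => //; apply: srB; [apply: IF | apply: sr1].
split=> //; split; first by rewrite HE Fc subrr mulr0 subrr !(mulr0, addr0).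
split.
  move=> x Dx; rewrite HE.
  have -> : x * (1 + e * (F.[x] - 1) + pi * c * (x ^+ (size F).+1 * (x - c))) / c =
      x * y + e * (x * F.[x] / c) + x * pi * x ^+ (size F).+1 * (x - c).
    by rewrite /e; field; rewrite cn0.
  apply: srD; first by apply: srD; apply: srM => //; apply: hF.
  by apply: srM; [apply: srM; [apply: srM | apply: srX] | apply: srB].
split; first by rewrite /H addrC size_polyDl // sB.
move=> g h eH; apply: (eisenstein maxQ Qpi Dt nt tQ _ _ lead _ eH).
- by rewrite -horner_coef0.
- move=> i; rewrite coefD /A coefD coefZ coefB coef1 /= add0r subr0 coefZ.
  have -> : (e * F`_i.+1 + pi * c * B`_i.+1) / pi = e / pi * (d^-1 * (d * F`_i.+1)) + c * B`_i.+1.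
    by field; rewrite pin0 dn0.
  apply: locD => //; last by apply: loc_D => //; apply: srM.
  apply: locM => //; first exact: (uniformizer_div maxQ Dt nt tQ).
  by apply: locM => //; [apply: loc_inv | apply: loc_D => //; rewrite -coefZ].
- exact: loc_inv.
Qed.

End Construction.

(** * Factorizations in Int(D) *)

Definition unit_of (a : K) := exists r, D r /\ r * a = 1.

Lemma Int_unitC a : D a -> unit_of a -> Int_unit D a%:P.
Proof.
move=> Da [r [Dr e]]; split; first by move=> x _; rewrite hornerC.
exists r%:P; split; first by move=> x _; rewrite hornerC.
by rewrite -polyCM mulrC e.
Qed.

Lemma Int_unit_size f : Int_unit D f -> size f = 1%N.
Proof. by move=> [_ [g [_ e]]]; have/eqP := size_poly1 K; rewrite -e size_mul_eq1 => /andP[/eqP]. Qed.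

Lemma int_valuedC a : int_valued D a%:P -> D a.
Proof. by move=> /(_ 0 sr0); rewrite hornerC. Qed.

(** Degrees force both factors to be constant, so irreducibility is inherited from [D]. *)
Lemma Int_irreducibleC q : D q -> q != 0 -> ~ unit_of q ->
  (forall a b, D a -> D b -> q = a * b -> unit_of a \/ unit_of b) -> Int_irreducible D q%:P.
Proof.
move=> Dq qn0 nuq irr; split; first by move=> x _; rewrite hornerC.
split; first by rewrite polyC_eq0.
split.
  move=> [_ [g [Ig e]]]; apply: nuq; exists g.[0]; split; first by apply: Ig; apply: sr0.
  by rewrite mulrC -[q](hornerC q 0) -hornerM e hornerC.
move=> g h Ig Ih e; have/eqP : size (g * h) = 1%N by rewrite -e size_polyC qn0.
rewrite size_mul_eq1 => /andP[/eqP sg /eqP sh].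
have eg : g = (g`_0)%:P by apply: size1_polyC; rewrite sg.
have eh : h = (h`_0)%:P by apply: size1_polyC; rewrite sh.
rewrite eg in Ig e *; rewrite eh in Ih e *.
have {}Ig := int_valuedC Ig; have {}Ih := int_valuedC Ih.
have e' : q = g`_0 * h`_0 by apply: polyC_inj; rewrite polyCM.
by case: (irr _ _ Ig Ih e') => ?; [left | right]; apply: Int_unitC.
Qed.

(** Take a generator of a principal ideal maximal among those of non-zero non-units. A non-unit
    factor generates a larger ideal, hence the same one, and its cofactor is a unit. *)
Lemma irreducible_element M : maximal_ideal D M -> (exists x, M x /\ x != 0) ->
  exists q, D q /\ q != 0 /\ ~ unit_of q /\
    forall a b, D a -> D b -> q = a * b -> unit_of a \/ unit_of b.
Proof.
move=> maxM [x [Mx xn0]]; have idM := maximal_isideal maxM.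
have [||J [[q [Dq [qn0 [nuq ->]]]] maxJ]] := noetherian_max
  (Fam := fun J => exists q, D q /\ q != 0 /\ ~ unit_of q /\ J = principal q).
- by move=> J [q [Dq [_ [_ ->]]]]; apply: principal_ideal.
- exists (principal x), x; split; first exact: ideal_D Mx.
  split => //; split => // -[r [Dr e]]; apply: (maximal_not1 maxM).
  by rewrite -e; apply: idealM.
exists q; do 3?[split=> //]; move=> a b Da Db e.
case: (classic (unit_of a)) => nua; [by left | right].
have [an0 bn0] : a != 0 /\ b != 0 by apply/andP; rewrite -negb_or -mulf_eq0 -e.
have [r [Dr ea]] : principal q a.
  apply: (maxJ (principal a)); last exact: principal_mem; first by exists a.
  by move=> z [r [Dr ->]]; exists (r * b); split; [apply: srM | rewrite e mulrAC mulrA].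
exists r; split => //; apply: (mulIf an0).
by rewrite mul1r {2}ea e; ring.
Qed.

(** * Irreducibility of [H] and of [x H / c] *)

Section Factorization.
Variables (c : K) (H : {poly K}).
Hypotheses (Dc : D c) (cn0 : c != 0) (nuc : ~ unit_of c).
Hypotheses (IH : int_valued D H) (H0 : H.[0] = 1) (Hc : H.[c] = 1).
Hypotheses (HG : forall x, D x -> D (x * H.[x] / c)) (sH : (1 < size H)%N).
Hypothesis irrH : forall g h, H = g * h -> (size g <= 1)%N \/ (size h <= 1)%N.

(** One factor is a constant, and the value 1 at 0 makes it invertible. *)
Lemma Int_irreducible_H : Int_irreducible D H.
Proof.
split=> //; split; first by rewrite -size_poly_gt0; apply: ltnW.
split; first by move=> /Int_unit_size sH1; move: sH; rewrite sH1.
have unitl g h : int_valued D g -> int_valued D h -> H = g * h -> (size g <= 1)%N -> Int_unit D g.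
  move=> Ig Ih e /size1_polyC eg; rewrite eg in Ig e *.
  apply: Int_unitC; first exact: int_valuedC.
  exists h.[0]; split; first by apply: Ih; apply: sr0.
  by rewrite -H0 e hornerM hornerC mulrC.
move=> g h Ig Ih e; case: (irrH e) => s; [left | right]; first exact: unitl e s.
by apply: (unitl h g) => //; rewrite mulrC.
Qed.

(** [X] divides one factor, and removing it yields a factorization of [H], so the rest of that
    factor or the other factor is constant. In the first case evaluation at 0 makes [c] a unit; in
    the second, evaluation at [c] inverts the constant. *)
Lemma Int_irreducible_G : Int_irreducible D (c^-1 *: ('X * H)).
Proof.
have Hn0 : H != 0 by rewrite -size_poly_gt0; apply: ltnW.
have GE x : (c^-1 *: ('X * H)).[x] = x * H.[x] / c.
  by rewrite hornerZ hornerM hornerX mulrC.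
split; first by move=> x Dx; rewrite GE; apply: HG.
split; first by rewrite scaler_eq0 invr_eq0 mulf_eq0 polyX_eq0 !negb_or cn0.
split.
  move=> /Int_unit_size; rewrite size_scale ?invr_eq0 // mulrC size_mulX // => -[s0].
  by move: sH; rewrite s0.
have unitr g h : int_valued D g -> int_valued D h -> c^-1 *: ('X * H) = g * h ->
    root g 0 -> Int_unit D h.
  move=> Ig Ih e /factor_theorem[g1 eg]; rewrite subr0 in eg.
  have eH : H = (c *: g1) * h.
    apply: (mulfI (x := 'X)); first by rewrite polyX_eq0.
    have -> : 'X * H = c *: (c^-1 *: ('X * H)) by rewrite scalerA mulfV // scale1r.
    by rewrite e eg -!mul_polyC; ring.
  case: (irrH eH) => [|/size1_polyC eh].
    rewrite size_scale // => /size1_polyC eg1; case: nuc.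
    (* The constant lies in [D] because it is the value of [g] at 1. *)
    have Da : D g1`_0 by have := Ig 1 sr1; rewrite eg eg1 hornerM hornerX hornerC mulr1 coefC.
    exists (g1`_0 * h.[0]); split; first by apply: srM => //; apply: Ih; apply: sr0.
    by rewrite -H0 eH hornerM hornerZ {2}eg1 hornerC; ring.
  rewrite eh in Ih e *; apply: Int_unitC; first exact: int_valuedC.
  exists g.[c]; split; first exact: Ig.
  by rewrite -[h`_0](hornerC _ c) -hornerM -e GE Hc mulr1 mulfV.
move=> g h Ig Ih e.
have : (g * h).[0] == 0 by rewrite -e GE !mul0r.
rewrite hornerM mulf_eq0 => /orP[r|r]; [right; exact: unitr e r | left].
by apply: (unitr h g) => //; rewrite [h * g]mulrC.
Qed.

End Factorization.
End Dedekind.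

Theorem theorem5p1 (K : fieldType) (D : K -> Prop) :
  dedekind_domain D -> is_quotient_field D ->
  infinitely_many_maximal_ideals D ->
  (forall M, maximal_ideal D M -> finite_index D M) ->
  forall n : nat, (1 <= n)%N ->
  exists (H : {poly K}) (G : 'I_n.+1 -> {poly K}),
    Int_irreducible D H /\ (forall i, Int_irreducible D (G i)) /\
    'X * H = \prod_(i < n.+1) G i.
Proof.
move=> dedD fracD infD finD [//|n] _; have ringD : is_subring D by case: dedD.
(* A zero maximal ideal would be contained in every other one, hence be the only one. *)
have maximal_neq0 M : maximal_ideal D M -> exists x, M x /\ x != 0.
  move=> [[Mid M1] Mmax]; apply: NNPP => M0.
  have Mz x : M x -> x = 0.
    by move=> Mx; apply: NNPP => /eqP xn0; apply: M0; exists x.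
  have [N [[[Nid N1] _] hN]] := infD 1%N (fun _ => M).
  have MN x : M x -> N x by move=> /Mz ->; apply: (ideal0 Nid).
  case: (Mmax N Nid MN) => // NM; apply: (hN ord0) => x; split; first exact: NM.
  exact: MN.
have [M [maxM _]] := infD 0%N (fun _ => fun _ => False).
have [q [Dq [qn0 [nuq irrq]]]] := irreducible_element dedD maxM (maximal_neq0 M maxM).
(* Here [n] is the predecessor of the given number, so [q] occurs as often as that number and
   [x H / c] is the one further factor. *)
pose c := q ^+ n.+1.
have Dc : D c by apply: subringX.
have cn0 : c != 0 by rewrite expf_neq0.
have nuc : ~ unit_of D c.
  move=> [r [Dr e]]; apply: nuq; exists (r * q ^+ n); split; last by rewrite -mulrA -exprSr.
  by apply: subringM => //; apply: subringX.
have [H [IH [H0 [Hc [HG [sH irrH]]]]]] :=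
  irreducible_fixed_divisor_poly dedD fracD maximal_neq0 finD infD Dc cn0.
exists H, (fun i : 'I_n.+2 => if (i < n.+1)%N then q%:P else c^-1 *: ('X * H)).
split; first exact: Int_irreducible_H.
split.
  by move=> i; case: ifP => _; [apply: Int_irreducibleC | apply: Int_irreducible_G].
rewrite big_ord_recr /= ltnn.
under eq_bigr => i _ do rewrite ltn_ord.
by rewrite prodr_const card_ord -polyC_exp mul_polyC scalerA mulfV // scale1r.
Qed.
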